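(* There exist symmetric spaces $E$ and $F$ on $[0,1]$, with fundamental functions $\varphi$ and $\psi$ respectively (both in $G$), such that $E\subset F$, $\lim_{t\to 0+}\psi(t)/\varphi(t)=0$, and the identity inclusion operator $I:E\to F$ is not disjointly strictly singular.
   Context: All functions are Lebesgue measurable on $[0,1]$, $\mu$ is Lebesgue measure. A symmetric space (SS) on $[0,1]$ is a Banach space $E$ of measurable functions on $[0,1]$ such that: (1) if $y\in E$ and $|x(t)|\le |y(t)|$ then $x\in E$ and $\|x\|\le\|y\|$; (2) if $y\in E$ and $x,y$ are equimeasurable (i.e. $\mu\{|x|>\tau\}=\mu\{|y|>\tau\}$ for all $\tau>0$) then $x\in E$ and $\|x\|=\|y\|$. The fundamental function of $E$ is $f_E(t)=\|\chi_{(0,t)}\|_E$. $G$ denotes the class of all positive increasing concave functions on $(0,1]$. A bounded linear operator $T$ from a Banach lattice $X$ into a Banach space $Y$ is disjointly strictly singular (DSS) if there is no sequence of nonzero pairwise disjoint elements $x_n\in X$ such that the restriction of $T$ to their closed linear span $[x_n]$ is an isomorphism (onto its image). *)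

(* Defs.v *)
From HB Require Import structures.
From mathcomp Require Import all_boot all_order all_algebra.
From mathcomp Require Import all_classical all_reals all_analysis.
Set Implicit Arguments. Unset Strict Implicit. Unset Printing Implicit Defensive.
Import Order.TTheory GRing.Theory Num.Theory.
Import numFieldNormedType.Exports.
Local Open Scope classical_set_scope.
Local Open Scope ring_scope.

Section Defs.
Variable R : realType.
Notation mu := (@lebesgue_measure R).

Definition I01 : set R := `[0, 1]%classic.

Definition ae01 (P : R -> Prop) : Prop :=
  mu.-negligible [set t | I01 t /\ ~ P t].

Definition equimeasurable (x y : R -> R) : Prop :=
  forall tau : R, 0 < tau ->
    mu [set t | I01 t /\ tau < `|x t|] = mu [set t | I01 t /\ tau < `|y t|].

(* A symmetric space on [0,1]: a set [mem] of measurable functions on [0,1]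
   with a norm [nrm] (elements identified a.e.), which is a Banach space,
   an ideal (property (1)) and rearrangement invariant (property (2)). *)
Definition is_symmetric_space (mem : (R -> R) -> Prop) (nrm : (R -> R) -> R)
  : Prop :=
  (forall x, mem x -> measurable_fun I01 x) /\
      (forall x, mem x -> 0 <= nrm x) /\
      (forall x, mem x -> (nrm x = 0 <-> ae01 (fun t => x t = 0))) /\
      (forall x y, mem x -> mem y ->
          mem (fun t => x t + y t) /\ nrm (fun t => x t + y t) <= nrm x + nrm y) /\
      (forall (a : R) x, mem x ->
          mem (fun t => a * x t) /\ nrm (fun t => a * x t) = `|a| * nrm x) /\
      (forall u : nat -> R -> R, (forall n, mem (u n)) ->
         (forall e : R, 0 < e -> exists N : nat, forall m n : nat,
             (N <= m)%N -> (N <= n)%N -> nrm (fun t => u m t - u n t) < e) ->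
         exists x, mem x /\ forall e : R, 0 < e -> exists N : nat,
             forall n : nat, (N <= n)%N -> nrm (fun t => u n t - x t) < e) /\
      (forall (x y : R -> R), mem y -> measurable_fun I01 x ->
         (forall t, I01 t -> `|x t| <= `|y t|) -> mem x /\ nrm x <= nrm y) /\
      (forall (x y : R -> R), mem y -> measurable_fun I01 x -> equimeasurable x y ->
         mem x /\ nrm x = nrm y).

Record SymSpace := {
  ss_mem : (R -> R) -> Prop;
  ss_nrm : (R -> R) -> R;
  ss_ax : is_symmetric_space ss_mem ss_nrm }.

Definition chi0 (t : R) : R -> R := fun s => if (0 < s) && (s < t) then 1 else 0.

Definition fund (E : SymSpace) : R -> R := fun t => ss_nrm E (chi0 t).

Definition in_G (phi : R -> R) : Prop :=
  [/\ (forall t, 0 < t <= 1 -> 0 < phi t),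
      (forall s t, 0 < s -> s <= t -> t <= 1 -> phi s <= phi t) &
      (forall s t (l : R), 0 < s <= 1 -> 0 < t <= 1 -> 0 <= l <= 1 ->
          l * phi s + (1 - l) * phi t <= phi (l * s + (1 - l) * t))].

Definition ss_included (E F : SymSpace) : Prop :=
  forall x, ss_mem E x -> ss_mem F x.

Definition incl_bounded (E F : SymSpace) : Prop :=
  exists C : R, 0 < C /\ forall x, ss_mem E x -> ss_nrm F x <= C * ss_nrm E x.

Definition in_closed_span (E : SymSpace) (xs : nat -> R -> R) (x : R -> R) : Prop :=
  ss_mem E x /\ forall e : R, 0 < e -> exists (n : nat) (a : nat -> R),
    ss_nrm E (fun t => x t - \sum_(i < n) a i * xs i t) < e.

Definition incl_DSS (E F : SymSpace) : Prop :=
  ~ exists xs : nat -> R -> R,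
      [/\ (forall n, ss_mem E (xs n) /\ ss_nrm E (xs n) <> 0),
          (forall n m, n <> m -> ae01 (fun t => xs n t * xs m t = 0)) &
          exists c C : R, 0 < c /\ 0 < C /\ forall x, in_closed_span E xs x ->
             c * ss_nrm E x <= ss_nrm F x /\ ss_nrm F x <= C * ss_nrm E x].
End Defs.

(* Main.v *)
Require Import Defs.
From HB Require Import structures.
From mathcomp Require Import all_boot all_order all_algebra.
From mathcomp Require Import all_classical all_reals all_analysis.
From mathcomp Require Import measurable_realfun ring lra.
Import Order.TTheory GRing.Theory Num.Theory.
Import numFieldNormedType.Exports.
Local Open Scope classical_set_scope.
Local Open Scope ring_scope.

(* [F] is [L^2] and [E] is the space of [x] in [L^2] with finite Marcinkiewicz
   norm [sup_s (phi s / s) * (integral of the decreasing rearrangement of x over (0, s))],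
   where [phi t = sqrt (t (1 - ln t))]; thus [fund F t = sqrt t] and
   [fund E t = sqrt t + phi t].
   The function [1 / phi] has finite Marcinkiewicz norm but is not in [L^2] near
   [0], so it can be cut into consecutive blocks of [L^2] norm 1. If [z] is a
   linear combination of blocks with coefficients bounded by [B], its Marcinkiewicz norm
   is at most that of [B / phi], while its [L^2] norm dominates each coefficient;
   hence the two norms are equivalent on the span of the blocks, although
   [sqrt t = o(phi t)]. *)

(** * Integrals over the unit interval and their invariance under equimeasurability *)

Section IntegralOnUnitInterval.
Set Implicit Arguments.
Unset Strict Implicit.
Context {R : realType}.
Notation mu := (@lebesgue_measure R).
Notation D := (@I01 R).
Implicit Types (x y f g : R -> R).

(** The weight meets two competing demands: [phi] must outgrow the square root at 0, while [1 / phi]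
    must stay outside L^2, since otherwise infinitely many consecutive blocks of norm 1 could not be
    cut from it. The factor [1 - ln t] achieves both: 1 / (t (1 - ln t)) has the antiderivative -ln
    (1 - ln t), which diverges at 0, though only doubly logarithmically. The factor also varies
    slowly enough that the integral of [1 / phi] over (0, s) is at most 2 s / phi s, and this is why
    the Marcinkiewicz norm of [1 / phi] is finite. For the same reason the Marcinkiewicz space alone
    is not contained in L^2. Intersecting it with L^2 under the sum of the norms makes the inclusion
    a contraction, and the fundamental function keeps the order of [phi]. The norms must be compared
    on the closed span, so the estimate for finite combinations has to be uniform in the number of
    blocks. *)

Lemma measurable_I01 : measurable D.
Proof. exact: measurable_itv. Qed.

Lemma mu_I01 : mu D = 1%E.
Proof. by rewrite /I01 lebesgue_measure_itv/= lte_fin ltr01 oppr0 adde0. Qed.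

Definition int01 f : \bar R := \int[mu]_(t in D) (f t)%:E.

Lemma int01_ge0 f : (forall t, D t -> 0 <= f t) -> (0 <= int01 f)%E.
Proof. by move=> f0; apply: integral_ge0 => t Dt; rewrite lee_fin f0. Qed.

Lemma le_int01 f g : measurable_fun D f -> measurable_fun D g ->
  (forall t, D t -> 0 <= f t) -> (forall t, D t -> f t <= g t) ->
  (int01 f <= int01 g)%E.
Proof.
move=> mf mg f0 fg; apply: ge0_le_integral.
- exact: measurable_I01.
- by move=> t Dt; rewrite lee_fin f0.
- exact/measurable_EFinP.
- exact/measurable_EFinP.
- by move=> t Dt; rewrite lee_fin fg.
Qed.

Lemma int01D f g : measurable_fun D f -> measurable_fun D g ->
  (forall t, D t -> 0 <= f t) -> (forall t, D t -> 0 <= g t) ->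
  int01 (fun t => f t + g t) = (int01 f + int01 g)%E.
Proof.
move=> mf mg f0 g0; rewrite /int01.
under eq_integral do rewrite EFinD.
rewrite ge0_integralD//.
- exact: measurable_I01.
- exact/measurable_EFinP.
- exact/measurable_EFinP.
Qed.

Lemma int01Z (a : R) f : 0 <= a -> measurable_fun D f ->
  (forall t, D t -> 0 <= f t) -> int01 (fun t => a * f t) = (a%:E * int01 f)%E.
Proof.
move=> a0 mf f0; rewrite /int01.
under eq_integral do rewrite EFinM.
rewrite ge0_integralZl_EFin//.
- exact: measurable_I01.
- exact/measurable_EFinP.
Qed.

Lemma int01_cst (a : R) : int01 (fun=> a) = a%:E.
Proof.
transitivity (a%:E * mu D)%E; last by rewrite mu_I01 mule1.
exact: (integral_cst mu measurable_I01 a%:E).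
Qed.

Lemma int01_eq0 f : measurable_fun D f -> (forall t, D t -> 0 <= f t) ->
  int01 f = 0%E <-> ae01 (fun t => f t = 0).
Proof.
move=> mf f0; have := @ae_eq_integral_abs _ _ _ mu D measurable_I01 (EFin \o f).
move=> /(_ ((measurable_EFinP _ _).2 mf)).
have -> : (\int[mu]_(t in D) `|(EFin \o f) t| = int01 f)%E.
  by apply: eq_integral => t; rewrite inE => Dt /=; rewrite ger0_norm ?f0.
move=> ->; rewrite /ae01.
have -> : [set t | D t /\ f t <> 0] = ~` [set t | D t -> EFin (f t) = cst 0%E t].
  apply/seteqP; split => t /=.
  - by move=> [Dt h] /(_ Dt)[].
  - by move/not_implyP => [Dt]/= h; split => // e; apply: h; rewrite e.
by [].
Qed.

(** Extending by 0 gives a function measurable on the whole line, which can push a measure forward.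
    The measure pushed below is Lebesgue measure restricted to the unit interval, so the values
    outside carry no mass. *)
Let abs0 x : R -> R := (fun t => `|x t|) \_ D.

Let mabs0 x : measurable_fun D x -> measurable_fun setT (abs0 x).
Proof.
move=> mx; have h : measurable_fun D (fun t => `|x t|) by exact: measurableT_comp.
exact: (measurable_restrictT _ measurable_I01).1 h.
Qed.

(** Equimeasurability speaks only of positive levels; level 0 is the increasing limit of the levels
    1 / (n + 1). *)
Let equimeas0 x y : measurable_fun D x -> measurable_fun D y ->
  equimeasurable x y ->
  mu [set t | D t /\ 0 < `|x t|] = mu [set t | D t /\ 0 < `|y t|].
Proof.
move=> mx my xy.
have E (z : R -> R) : measurable_fun D z ->
    mu [set t | D t /\ n.+1%:R^-1 < `|z t|] @[n --> \oo] -->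
    mu [set t | D t /\ 0 < `|z t|].
  move=> mz.
  have -> : [set t | D t /\ 0 < `|z t|] =
      \bigcup_n [set t | D t /\ n.+1%:R^-1 < `|z t|].
    apply/seteqP; split => t /=.
      move=> [Dt z0]; have [n zn] := ltr_add_invr z0.
      by exists n => //; split => //; rewrite add0r in zn.
    by move=> [n _ [Dt zn]]; split => //; exact: lt_trans zn.
  have M n : measurable [set t | D t /\ n.+1%:R^-1 < `|z t|].
    have h : measurable_fun D (fun t => `|z t|) by exact: measurableT_comp.
    have -> : [set t | D t /\ n.+1%:R^-1 < `|z t|] =
        D `&` (fun t => `|z t|) @^-1` `]n.+1%:R^-1, +oo[%classic.
      by apply/seteqP; split => t /=; rewrite in_itv/= andbT.
    exact: h measurable_I01 _ (measurable_itv _).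
  apply: nondecreasing_cvg_mu => //.
    by apply: bigcup_measurable => n _; exact: M.
  move=> m n mn; rewrite subsetEset => t /= [Dt zm]; split => //.
  by apply: le_lt_trans zm; rewrite lef_pV2 ?posrE ?ltr0n// ler_nat.
have := E y my; have := E x mx.
under eq_fun do rewrite xy//.
by move=> h1 h2; exact: (cvg_unique _ h1 h2).
Qed.

(** The integral depends only on the distribution of |x|. The distributions of |x| and |y| agree on
    open half-lines, which form a generating pi-system, hence on all Borel sets. *)
Lemma equimeasurable_int01 (Phi : R -> R) x y :
  measurable_fun D x -> measurable_fun D y -> equimeasurable x y ->
  measurable_fun setT Phi -> (forall u, 0 <= u -> 0 <= Phi u) ->
  int01 (fun t => Phi `|x t|) = int01 (fun t => Phi `|y t|).
Proof.
move=> mx my xy mPhi Phi0.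
have mD := measurable_I01.
pose nu : {measure set (measurableTypeR R) -> \bar R} := mrestr mu mD.
pose m (z : measurableTypeR R -> measurableTypeR R) (mz : measurable_fun setT z) :
    {measure set (measurableTypeR R) -> \bar R} :=
  measure_function_pushforward__canonical__measure_function_Measure nu mz.
pose m1 := m _ (mabs0 mx); pose m2 := m _ (mabs0 my).
have E (z : R -> R) : measurable_fun D z -> forall r, nu ((abs0 z) @^-1` `]r, +oo[%classic) =
    mu [set t | D t /\ r < `|z t|].
  move=> mz r; rewrite /nu /mrestr; congr (mu _); apply/seteqP; split => t /=.
    by move=> [+ Dt]; rewrite in_itv/= andbT /abs0 patchE mem_set.
  by move=> [Dt rz]; rewrite in_itv/= andbT /abs0 patchE mem_set.
have m12 A : measurable A -> m1 A = m2 A.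
  apply: (@measure_unique _ R (measurableTypeR R) (@RGenOInfty.G R)
    (fun n => `](- n%:R), +oo[%classic) _ _ _ _ m1 m2).
  - exact: RGenOInfty.measurableE.
  - move=> _ _ [a ->] [b ->]; exists (Num.max a b).
    by apply/seteqP; split => t /=; rewrite !in_itv/= !andbT gt_max => /andP.
  - by move=> n; exists (- n%:R).
  - apply/seteqP; split => // t _.
    exists (Num.truncn `|t|).+1 => //=; rewrite in_itv/= andbT ltrNl.
    by apply: le_lt_trans (truncnS_gt _); rewrite -normrN ler_norm.
  - move=> _ [r ->]; transitivity (mu [set t | D t /\ r < `|x t|]); first exact: E.
    transitivity (mu [set t | D t /\ r < `|y t|]); last exact/esym/E.
    (* Below level 0 both sets are the whole unit interval; above it the hypothesis applies. *)
    have [r0|r0|->] := ltgtP r 0; last exact: equimeas0.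
      congr (mu _); apply/seteqP; split => t /= [Dt _]; split => //;
        exact: lt_le_trans r0 _.
    exact: xy.
  - move=> n; rewrite /m1 /pushforward /=.
    apply: (@le_lt_trans _ _ (mu D)); last by rewrite mu_I01 ltry.
    rewrite /nu /mrestr; apply: le_measure; rewrite ?inE//.
    apply: measurableI => //; rewrite -[X in measurable X]setTI.
    exact: (mabs0 mx).
have mE : measurable_fun setT (EFin \o Phi) by exact/measurable_EFinP.
(* The integral is taken over the half-line where |z| takes its values, as [Phi] is assumed
   nonnegative only there. *)
have E2 (z : R -> R) (mz : measurable_fun D z) :
    int01 (fun t => Phi `|z t|) =
    (\int[m _ (mabs0 mz)]_(u in `[0%R, +oo[) (Phi u)%:E)%E.
  have azm : measurable_fun setT (abs0 z) by exact: mabs0.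
  rewrite (@ge0_integral_pushforward _ _ (measurableTypeR R) (measurableTypeR R) R _
    (mabs0 mz) nu _ (EFin \o Phi))//.
  - have -> : abs0 z @^-1` `[0, +oo[%classic = setT.
      apply/seteqP; split => // t _ /=; rewrite in_itv/= andbT /abs0 patchE.
      by case: ifP.
    have mPz : measurable_fun setT ((EFin \o Phi) \o abs0 z) by exact: measurableT_comp.
    rewrite (@ge0_negligible_integral _ _ _ nu setT (~` D))//.
    + rewrite setTD setCK /int01 (eq_measure_integral nu).
        apply: eq_integral => t; rewrite inE => Dt.
        by rewrite /= /abs0 patchE mem_set.
      by move=> A mA AD; rewrite -[in LHS](setIidl AD).
    + exact: measurableC.
    + by move=> t _ /=; rewrite lee_fin Phi0// /abs0 patchE; case: ifP.
    + by transitivity (mu (~` D `&` D)); rewrite // setICl measure0.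
  - exact/measurable_funTS.
  - by move=> u; rewrite inE/= in_itv/= andbT lee_fin => /Phi0.
rewrite (E2 x mx) (E2 y my).
apply: eq_measure_integral => A mA _; exact: m12.
Qed.

End IntegralOnUnitInterval.

(** * The L^2 norm and its lattice and rearrangement properties *)

Section L2Norm.
Set Implicit Arguments.
Unset Strict Implicit.
Context {R : realType}.
Notation D := (@I01 R).
Implicit Types x y : R -> R.

Definition sqint x : \bar R := int01 (fun t => x t ^+ 2).

Definition inL2 x := measurable_fun D x /\ (sqint x < +oo)%E.

Definition norm2 x : R := Num.sqrt (fine (sqint x)).

Lemma norm2_ge0 x : 0 <= norm2 x. Proof. exact: sqrtr_ge0. Qed.

Lemma sqint_ge0 x : (0 <= sqint x)%E.
Proof. by apply: int01_ge0 => t _; exact: sqr_ge0. Qed.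

Lemma sqintE x : inL2 x -> sqint x = (norm2 x ^+ 2)%:E.
Proof.
move=> [_ xoo]; have x0 := sqint_ge0 x.
by rewrite /norm2 sqr_sqrtr ?fine_ge0// fineK// ge0_fin_numE.
Qed.

Lemma norm2_le x c : measurable_fun D x -> 0 <= c ->
  (sqint x <= (c ^+ 2)%:E)%E -> inL2 x /\ norm2 x <= c.
Proof.
move=> mx c0 xc; have Lx : inL2 x by split => //; exact: le_lt_trans xc (ltry _).
split => //; move: xc; rewrite sqintE// lee_fin.
by rewrite ler_sqr ?nnegrE ?norm2_ge0.
Qed.

Lemma norm2_mono x y : measurable_fun D x -> inL2 y ->
  (forall t, D t -> `|x t| <= `|y t|) -> inL2 x /\ norm2 x <= norm2 y.
Proof.
move=> mx Ly xy; apply: norm2_le => //; first exact: norm2_ge0.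
rewrite -sqintE//; apply: le_int01.
- exact: measurable_funX.
- by apply: measurable_funX; exact: Ly.1.
- by move=> t _; exact: sqr_ge0.
- move=> t Dt; rewrite -(real_normK (num_real (x t))) -(real_normK (num_real (y t))).
  by rewrite ler_sqr ?nnegrE// xy.
Qed.

Lemma norm2_equimeasurable x y : inL2 y -> measurable_fun D x ->
  equimeasurable x y -> inL2 x /\ norm2 x = norm2 y.
Proof.
move=> Ly mx xy; suff e : sqint x = sqint y.
  by rewrite /norm2 /inL2 e; split => //; split => //; exact: Ly.2.
have E (z : R -> R) : sqint z = int01 (fun t => `|z t| ^+ 2).
  by congr int01; apply/funext => t; rewrite real_normK ?num_real.
rewrite !E; apply: (@equimeasurable_int01 R (fun u => u ^+ 2)) => //.
  exact: Ly.1.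
by move=> u _; exact: sqr_ge0.
Qed.

Lemma norm2Z (a : R) x : inL2 x ->
  inL2 (fun t => a * x t) /\ norm2 (fun t => a * x t) = `|a| * norm2 x.
Proof.
move=> [mx xoo].
have e : sqint (fun t => a * x t) = ((a ^+ 2)%:E * sqint x)%E.
  rewrite /sqint -int01Z ?sqr_ge0//; last first.
    by move=> t _; exact: sqr_ge0.
    exact: measurable_funX.
  by congr int01; apply/funext => t; rewrite exprMn.
have mxa : measurable_fun D (fun t => a * x t) by exact: measurable_funM.
split.
  split => //; rewrite e sqintE//; exact: ltry.
rewrite /norm2 e sqintE//= sqrtrM ?sqr_ge0// !sqrtr_sqr.
by rewrite (ger0_norm (norm2_ge0 _)).
Qed.

(* With [al > norm2 x] and [be > norm2 y], integrate
   [(a + b)^2 <= (al + be) (a^2 / al + b^2 / be)]. *)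
Lemma norm2D x y : inL2 x -> inL2 y ->
  inL2 (fun t => x t + y t) /\ norm2 (fun t => x t + y t) <= norm2 x + norm2 y.
Proof.
move=> Lx Ly; have [mx _] := Lx; have [my _] := Ly.
have mxy : measurable_fun D (fun t => x t + y t) by exact: measurable_funD.
have key e : 0 < e -> (sqint (fun t => x t + y t)%R <=
    ((norm2 x + norm2 y + e) ^+ 2)%:E)%E.
  move=> e0; set al := norm2 x + e / 2; set be := norm2 y + e / 2.
  have al0 : 0 < al by rewrite ltr_wpDl ?norm2_ge0// divr_gt0.
  have be0 : 0 < be by rewrite ltr_wpDl ?norm2_ge0// divr_gt0.
  have p0 : 0 <= (al + be) / al by rewrite divr_ge0// ltW// addr_gt0.
  have q0 : 0 <= (al + be) / be by rewrite divr_ge0// ltW// addr_gt0.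
  have m2 (z : R -> R) : measurable_fun D z -> measurable_fun D (fun t => z t ^+ 2).
    by move=> mz; exact: measurable_funX.
  have mp (p : R) (z : R -> R) : measurable_fun D z -> measurable_fun D (fun t => p * z t).
    by move=> mz; exact: measurable_funM.
  apply: (@le_trans _ _ (int01 (fun t => (al + be) / al * x t ^+ 2 +
      (al + be) / be * y t ^+ 2)%R)).
    apply: le_int01.
    - exact: m2.
    - by apply: measurable_funD; apply: mp; exact: m2.
    - by move=> t _; exact: sqr_ge0.
    - move=> t _; rewrite -subr_ge0.
      have -> : (al + be) / al * x t ^+ 2 + (al + be) / be * y t ^+ 2 -
          (x t + y t) ^+ 2 = (be * x t - al * y t) ^+ 2 / (al * be).
        by field; rewrite !gt_eqF.
      by rewrite divr_ge0 ?sqr_ge0// mulr_ge0// ltW.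
  rewrite int01D ?int01Z//; last 8 first.
  - exact: m2.
  - by move=> t _; exact: sqr_ge0.
  - exact: m2.
  - by move=> t _; exact: sqr_ge0.
  - by apply: mp; exact: m2.
  - by apply: mp; exact: m2.
  - by move=> t _; rewrite mulr_ge0 ?sqr_ge0.
  - by move=> t _; rewrite mulr_ge0 ?sqr_ge0.
  rewrite -/(sqint x) -/(sqint y) !sqintE// -!EFinM -EFinD lee_fin.
  have -> : norm2 x + norm2 y + e = al + be by rewrite /al /be; field.
  have h1 : (al + be) / al * norm2 x ^+ 2 <= (al + be) / al * al ^+ 2.
    by rewrite ler_wpM2l// ler_sqr ?nnegrE ?norm2_ge0 ?(ltW al0)// lerDl divr_ge0// ltW.
  have h2 : (al + be) / be * norm2 y ^+ 2 <= (al + be) / be * be ^+ 2.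
    by rewrite ler_wpM2l// ler_sqr ?nnegrE ?norm2_ge0 ?(ltW be0)// lerDl divr_ge0// ltW.
  have -> : (al + be) ^+ 2 = (al + be) / al * al ^+ 2 + (al + be) / be * be ^+ 2.
    by field; rewrite !gt_eqF.
  exact: lerD.
have c0 e : 0 < e -> 0 <= norm2 x + norm2 y + e.
  by move=> e0; rewrite addr_ge0 ?(ltW e0)// addr_ge0 ?norm2_ge0.
split; first exact: (norm2_le mxy (c0 1 ltr01) (key 1 ltr01)).1.
by apply/ler_addgt0Pr => e e0; exact: (norm2_le mxy (c0 e e0) (key e e0)).2.
Qed.

Lemma norm2B x y : inL2 x -> inL2 y ->
  inL2 (fun t => x t - y t) /\ norm2 (fun t => x t - y t) <= norm2 x + norm2 y.
Proof.
move=> Lx Ly; have [LNy nNy] := norm2Z (-1) Ly.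
have := norm2D Lx LNy; rewrite nNy normrN1 mul1r.
by under eq_fun do rewrite mulN1r.
Qed.

Lemma norm2_eq0 x : inL2 x -> norm2 x = 0 <-> ae01 (fun t => x t = 0).
Proof.
move=> Lx; have [mx _] := Lx.
have := @int01_eq0 R (fun t => x t ^+ 2) (measurable_funX _ mx)
  (fun t _ => sqr_ge0 _).
have -> : ae01 (fun t => x t ^+ 2 = 0) <-> ae01 (fun t => x t = 0).
  rewrite /ae01; set A := [set _ | _]; set B := [set _ | _].
  suff -> : A = B by [].
  by apply/seteqP; split => t /= [Dt h]; split => // e; apply: h; move: e;
    [move=> ->; rewrite expr0n|move/eqP; rewrite sqrf_eq0 => /eqP].
move=> <-; rewrite -/(sqint x) sqintE//; split => [->|[/eqP]]; first by rewrite expr0n.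
by rewrite sqrf_eq0 => /eqP.
Qed.

End L2Norm.

(** * Completeness of L^2 (Riesz-Fischer) *)

Section L2Completeness.
Set Implicit Arguments.
Unset Strict Implicit.
Context {R : realType}.
Notation mu := (@lebesgue_measure R).
Notation D := (@I01 R).

(** Cauchy-Schwarz on a probability space, through |x| <= x^2 / (2c) + c / 2. A positive [c] above
    the norm allows the division even when the norm is 0. *)
Lemma int01_norm_le (x : R -> R) c : inL2 x -> 0 < c -> norm2 x <= c ->
  (int01 (fun t => `|x t|)%R <= c%:E)%E.
Proof.
move=> Lx c0 xc; have [mx _] := Lx.
have c2 : 0 <= (2 * c)^-1 by rewrite invr_ge0 mulr_ge0// ltW.
apply: (@le_trans _ _ (int01 (fun t => (2 * c)^-1 * x t ^+ 2 + c / 2)%R)).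
  apply: le_int01.
  - exact: measurableT_comp.
  - by apply: measurable_funD => //; apply: measurable_funM => //; exact: measurable_funX.
  - by [].
  - move=> t _; rewrite -(real_normK (num_real (x t))) -subr_ge0.
    have -> : (2 * c)^-1 * `|x t| ^+ 2 + c / 2 - `|x t| = (`|x t| - c) ^+ 2 / (2 * c).
      by field; rewrite gt_eqF.
    by rewrite divr_ge0 ?sqr_ge0// mulr_ge0// ltW.
rewrite int01D; last 4 first.
- by apply: measurable_funM => //; exact: measurable_funX.
- by [].
- by move=> t _; rewrite mulr_ge0 ?sqr_ge0.
- by move=> t _; rewrite divr_ge0// ltW.
rewrite int01Z//; last 2 first.
- exact: measurable_funX.
- by move=> t _; exact: sqr_ge0.
rewrite int01_cst -/(sqint x) sqintE// -EFinM -EFinD lee_fin.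
apply: (@le_trans _ _ ((2 * c)^-1 * c ^+ 2 + c / 2)).
  by rewrite lerD2r ler_wpM2l// ler_sqr ?nnegrE ?norm2_ge0// ltW.
by rewrite le_eqVlt; apply/orP; left; apply/eqP; field; rewrite gt_eqF.
Qed.

Lemma limn_einf_le (f : nat -> \bar R) c N :
  (forall k, (N <= k)%N -> (f k <= c)%E) -> (limn_einf f <= c)%E.
Proof.
move=> fc; rewrite limn_einf_lim (cvg_lim _ (@cvg_einfs_sup R f))//.
apply: ge_ereal_sup => _ [n _ <-].
apply: (@le_trans _ _ (f (maxn n N))); last by apply: fc; exact: leq_maxr.
by apply: ereal_inf_lbound; exists (maxn n N) => //=; exact: leq_maxl.
Qed.

Lemma cvg_of_summable_increments (v : nat -> R) (S : R) :
  (forall n, \sum_(0 <= k < n) `|v k.+1 - v k| <= S) -> cvgn v.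
Proof.
move=> vS; have nd : nondecreasing_seq [normed series (telescope v)].
  by apply: nondecreasing_series => n _ _; exact: normr_ge0.
have c : cvgn (series (telescope v)).
  apply: normed_cvg; apply: nondecreasing_is_cvgn => //.
  by exists S => _ [n _ <-]; exact: vS.
have -> : v = (fun n => v 0%N + series (telescope v) n).
  by apply/funext => n; exact: eq_sum_telescope.
exact: is_cvgD (is_cvg_cst _) c.
Qed.

(** The L^1 norms of the increments are bounded by their L^2 norms, whose sum is at most 1. The
    series of absolute increments is therefore integrable, hence finite almost everywhere. *)
Lemma ae_cvg_fast_cauchy (v : nat -> R -> R) : (forall k, inL2 (v k)) ->
  (forall k, norm2 (fun t => v k.+1 t - v k t) <= 1 / (2 ^ k.+1)%:R) ->
  {ae mu, forall t, D t -> cvgn (fun k => v k t)}.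
Proof.
move=> Lv dv; have mD := @measurable_I01 R.
pose d (k : nat) (t : R) : R := `|v k.+1 t - v k t|.
have md k : measurable_fun D (d k).
  by apply: measurableT_comp => //; apply: measurable_funB; exact: (Lv _).1.
have mEd k : measurable_fun D (fun t => (d k t)%:E) by exact/measurable_EFinP.
have d0 k t : D t -> (0%:E <= (d k t)%:E)%E by rewrite lee_fin normr_ge0.
have mS : measurable_fun D (fun t => \sum_(0 <= k <oo) (d k t)%:E)%E.
  by apply: ge0_emeasurable_sum => [k t Dt _|k _]; [exact: d0|exact: mEd].
have iS : mu.-integrable D (fun t => \sum_(0 <= k <oo) (d k t)%:E)%E.
  apply/integrableP; split => //.
  under eq_integral => t.
    rewrite inE => Dt; rewrite gee0_abs; last by apply: nneseries_ge0 => k _ _; exact: d0.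
  over.
  rewrite integral_nneseries//.
  apply: (@le_lt_trans _ _ 1%:E); last exact: ltry.
  apply: le_trans (epsilon_trick0 xpredT ler01).
  apply: lee_nneseries => k _ ; first by move=> _; apply: integral_ge0 => t; exact: d0.
  apply: int01_norm_le; [exact: (norm2B _ _).1| |exact: dv].
  by rewrite divr_gt0// ltr0n expn_gt0.
have := @integrable_ae _ (measurableTypeR R) R mu D mD _ iS.
apply: filterS => t + Dt => /(_ Dt) Sfin.
apply: (@cvg_of_summable_increments _ (fine (\sum_(0 <= k <oo) (d k t)%:E)%E)) => n.
rewrite -lee_fin fineK// -sumEFin; apply: nneseries_lim_ge => k _ _.
exact: d0.
Qed.

Lemma L2_complete (u : nat -> R -> R) : (forall n, inL2 (u n)) ->
  (forall e : R, 0 < e -> exists N : nat, forall m n : nat,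
     (N <= m)%N -> (N <= n)%N -> norm2 (fun t => u m t - u n t) < e) ->
  exists x, inL2 x /\ forall e : R, 0 < e -> exists N : nat,
    forall n : nat, (N <= n)%N -> norm2 (fun t => u n t - x t) <= e.
Proof.
move=> Lu cu; have mD := @measurable_I01 R.
have e0 k : 0 < 1 / (2 ^ k.+1)%:R :> R by rewrite divr_gt0// ltr0n expn_gt0.
have [N hN] := choice (fun k => cu _ (e0 k)).
(* This index dominates every [N j] with j <= k, and also [k] itself, so that [M k] tends to
   infinity. *)
pose M k := (k + \sum_(j < k.+1) N j)%N.
have NM j k : (j <= k)%N -> (N j <= M k)%N.
  move=> jk; rewrite /M (bigD1 (Ordinal (jk : (j < k.+1)%N)))//=.
  by rewrite addnCA leq_addr.
pose v k := u (M k).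
have vcvg : {ae mu, forall t, D t -> cvgn (fun k => v k t)}.
  apply: ae_cvg_fast_cauchy => [k|k]; first exact: Lu.
  by apply/ltW/hN; apply: NM.
(* The upper limit is measurable and defined everywhere; its value off the convergence set, 0 where
   it is infinite, concerns a null set only. *)
pose x t := fine (limn_esup (fun k => (v k t)%:E)).
have mx : measurable_fun D x.
  apply: (@measurableT_comp _ _ _ _ _ _ fine); first exact: fine_measurable.
  apply: measurable_fun_limn_esup => k.
  by apply/measurable_EFinP; exact: (Lu _).1.
have xv t : cvgn (fun k => v k t) -> v k t @[k --> \oo] --> x t.
  move=> ct; have ct' : (v k t)%:E @[k --> \oo] --> (limn (fun k => v k t))%:E.
    by apply: cvg_EFin; [exact: nearW|exact: ct].
  by rewrite /x (cvg_limn_einf_sup ct').2.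
(* Fatou's lemma: a bound on the distances from [u n] to the [v k], valid from the index [e] on,
   passes to the limit. *)
have dist e (c : R) n : (0 <= c) -> (forall k, (e <= k)%N -> norm2 (fun t => u n t - v k t) <= c) ->
    inL2 (fun t => u n t - x t) /\ norm2 (fun t => u n t - x t) <= c.
  move=> c0 hc; have mun k : measurable_fun D (fun t => u n t - v k t).
    by apply: measurable_funB; exact: (Lu _).1.
  have mux : measurable_fun D (fun t => u n t - x t).
    by apply: measurable_funB => //; exact: (Lu _).1.
  have mE k : measurable_fun D (fun t => ((u n t - v k t) ^+ 2)%:E).
    by apply/measurable_EFinP; exact: measurable_funX.
  apply: norm2_le => //.
  apply: (@le_trans _ _
      (\int[mu]_(t in D) limn_einf (fun k => ((u n t - v k t) ^+ 2)%R%:E))%E).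
    apply: ae_ge0_le_integral => //.
    - by move=> t _; rewrite lee_fin sqr_ge0.
    - by apply/measurable_EFinP; exact: measurable_funX.
    - move=> t _; rewrite limn_einf_lim; apply: lime_ge; first exact: is_cvg_einfs.
      by apply: nearW => k; apply: le_ereal_inf_tmp => _ [j _ <-]; rewrite lee_fin sqr_ge0.
    - have -> : (fun t => limn_einf (fun k => ((u n t - v k t) ^+ 2)%:E)) =
          (fun t => - limn_esup (fun k => - ((u n t - v k t) ^+ 2)%:E))%E.
        apply/funext => t; rewrite -[LHS]oppeK -limn_esupN//.
      apply: measurableT_comp => //; apply: measurable_fun_limn_esup => k.
      by apply: measurableT_comp => //; exact: mE.
    - have [A [mA A0 hA]] := vcvg; exists A; split => // t /= nle.
      apply: hA => /= ct; apply: nle => Dt; have {}ct := xv _ (ct Dt).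
      have h : ((u n t - v k t) ^+ 2)%:E @[k --> \oo] --> ((u n t - x t) ^+ 2)%:E.
        apply: cvg_EFin; first exact: nearW.
        have h0 : u n t - v k t @[k --> \oo] --> u n t - x t.
          by apply: cvgB ct; exact: cvg_cst.
        exact: (cvgM h0 h0).
      by rewrite (cvg_limn_einf_sup h).1.
  apply: le_trans (fatou _ _ _ _) _ => //.
    by move=> k t _; rewrite lee_fin sqr_ge0.
  apply: (@limn_einf_le _ _ e) => k ek.
  have L := (norm2B (Lu n) (Lu (M k))).1.
  rewrite -/(int01 _) -/(sqint _) (sqintE L) lee_fin.
  by rewrite ler_sqr ?nnegrE ?norm2_ge0// hc.
have Lx : inL2 x.
  have [L _] := @dist 0%N (1 / (2 ^ 1)%:R) (N 0%N) (ltW (e0 _))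
    (fun k _ => ltW (hN 0%N _ _ (leqnn _) (NM _ _ (leq0n k)))).
  have := (norm2B (Lu (N 0%N)) L).1.
  by under eq_fun do rewrite opprB addrCA subrr addr0.
exists x; split => // e e1; have [K hK] := cu e e1.
exists K => n Kn.
have [k Kk|_ hle] := @dist K e n (ltW e1); last exact: hle.
by apply/ltW/hK => //; exact: leq_trans Kk (leq_addr _ _).
Qed.

End L2Completeness.

(** * Symmetric spaces normed by the L^2 norm plus a supremum of seminorms *)

Section SeminormFamily.
Set Implicit Arguments.
Unset Strict Implicit.
Context {R : realType}.
Notation D := (@I01 R).
Implicit Types x y : R -> R.

(** These conditions make the L^2 norm plus the supremum of the [p s] a symmetric norm, so that both
    spaces come from one verification. In the last field the constant depends on [s]: each seminorm
    is continuous on L^2, while the supremum may be infinite there. *)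
Record rearrangement_seminorms (p : R -> (R -> R) -> R) : Prop := {
  psn_ge0 : forall s x, inL2 x -> 0 <= p s x;
  psnD : forall s x y, inL2 x -> inL2 y ->
    p s (fun t => x t + y t) <= p s x + p s y;
  psnZ : forall s (a : R) x, inL2 x -> p s (fun t => a * x t) = `|a| * p s x;
  psn_mono : forall s x y, measurable_fun D x -> inL2 y ->
    (forall t, D t -> `|x t| <= `|y t|) -> p s x <= p s y;
  psn_equimeasurable : forall s x y, measurable_fun D x -> inL2 y ->
    equimeasurable x y -> p s x = p s y;
  psn_dominated : forall s, exists2 C : R, 0 <= C &
    forall x, inL2 x -> p s x <= C * norm2 x }.

Variable p : R -> (R -> R) -> R.
Hypothesis hp : rearrangement_seminorms p.

(** On an unbounded range [sup] is a default value, hence the separate condition [pbounded] in the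
    membership predicate. *)
Definition psup x : R := sup (range (fun s => p s x)).

Definition pbounded x : Prop := has_ubound (range (fun s => p s x)).

Lemma psup_ub x s : pbounded x -> p s x <= psup x.
Proof. by move=> bx; apply: ub_le_sup => //; exists s. Qed.

Lemma psup_le x c : (forall s, p s x <= c) -> pbounded x /\ psup x <= c.
Proof.
move=> xc; split; first by exists c => _ [s _ <-].
by apply: ge_sup; [exists (p 0 x), 0|move=> _ [s _ <-]].
Qed.

Lemma psup_ge0 x : inL2 x -> pbounded x -> 0 <= psup x.
Proof. by move=> Lx bx; apply: le_trans (psup_ub 0 bx); exact: psn_ge0. Qed.

Definition smem x : Prop := inL2 x /\ pbounded x.

Definition snrm x : R := norm2 x + psup x.

Lemma norm2_snrm x : smem x -> norm2 x <= snrm x.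
Proof. by move=> [Lx bx]; rewrite /snrm lerDl psup_ge0. Qed.

Lemma psn_snrm x s : smem x -> p s x <= snrm x.
Proof.
by move=> [Lx bx]; rewrite /snrm (le_trans (psup_ub s bx))// lerDr norm2_ge0.
Qed.

Lemma snrmD x y : smem x -> smem y ->
  smem (fun t => x t + y t) /\ snrm (fun t => x t + y t) <= snrm x + snrm y.
Proof.
move=> [Lx bx] [Ly by_]; have [Lxy nxy] := norm2D Lx Ly.
have [s|bxy sxy] := @psup_le (fun t => x t + y t) (psup x + psup y).
  by apply: le_trans (psnD hp s Lx Ly) _; apply: lerD; exact: psup_ub.
by split; [|rewrite /snrm addrACA; exact: lerD].
Qed.

Lemma snrmZ (a : R) x : smem x ->
  smem (fun t => a * x t) /\ snrm (fun t => a * x t) = `|a| * snrm x.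
Proof.
move=> [Lx bx]; have [Lax nax] := norm2Z a Lx.
have [s|bax sax] := @psup_le (fun t => a * x t) (`|a| * psup x).
  by rewrite psnZ// ler_wpM2l// psup_ub.
split => //; rewrite /snrm nax mulrDr; congr (_ + _).
apply/eqP; rewrite eq_le sax/=.
have [a0|a0] := eqVneq a 0.
  by rewrite [X in `|X|]a0 normr0 mul0r; exact: psup_ge0.
rewrite mulrC -ler_pdivlMr ?normr_gt0//; apply: (psup_le _).2 => s.
by rewrite ler_pdivlMr ?normr_gt0// mulrC -psnZ// psup_ub.
Qed.

Lemma snrmB x y : smem x -> smem y ->
  smem (fun t => x t - y t) /\ snrm (fun t => x t - y t) <= snrm x + snrm y.
Proof.
move=> mx my; have [mNy nNy] := snrmZ (-1) my.
have := snrmD mx mNy; rewrite nNy normrN1 mul1r.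
by under eq_fun do rewrite mulN1r.
Qed.

(** The limit [x] is the one in L^2. For fixed [s], split [u n - x] at [u m]: the first part is
    small uniformly in [s] by the Cauchy condition, and the second tends to 0 because [p s] is
    dominated by the L^2 norm. Only [m] depends on [s], so the resulting bound survives the
    supremum. *)
Lemma snrm_complete (u : nat -> R -> R) : (forall n, smem (u n)) ->
  (forall e : R, 0 < e -> exists N : nat, forall m n : nat,
     (N <= m)%N -> (N <= n)%N -> snrm (fun t => u m t - u n t) < e) ->
  exists x, smem x /\ forall e : R, 0 < e -> exists N : nat,
    forall n : nat, (N <= n)%N -> snrm (fun t => u n t - x t) < e.
Proof.
move=> mu_ cu.
have mB m n := (snrmB (mu_ m) (mu_ n)).1.
have [x [Lx ux]] : exists x, inL2 x /\ forall e : R, 0 < e -> exists N : nat,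
    forall n : nat, (N <= n)%N -> norm2 (fun t => u n t - x t) <= e.
  apply: L2_complete => [n|e e0]; first exact: (mu_ n).1.
  have [N hN] := cu e e0; exists N => m n Nm Nn.
  by apply: le_lt_trans (hN m n Nm Nn); exact: norm2_snrm.
have Lux n : inL2 (fun t => u n t - x t) by exact: (norm2B (mu_ n).1 Lx).1.
have key e N : 0 < e -> (forall m n : nat, (N <= m)%N -> (N <= n)%N ->
    snrm (fun t => u m t - u n t) < e) -> forall n, (N <= n)%N -> forall s,
    p s (fun t => u n t - x t) <= e.
  move=> e0 hN n Nn s; have [C C0 hC] := psn_dominated hp s.
  (* Dividing by C + 1 rather than C covers C = 0. *)
  apply/ler_addgt0Pr => d d0; have dC : 0 < d / (C + 1) by rewrite divr_gt0// ltr_wpDl.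
  have [K hK] := ux _ dC; pose m := maxn K N.
  have -> : (fun t => u n t - x t) = (fun t => (u n t - u m t) + (u m t - x t)).
    by apply/funext => t; rewrite addrA subrK.
  apply: le_trans (psnD hp s (mB n m).1 (Lux m)) _; apply: lerD.
    apply: le_trans (psn_snrm s (mB n m)) _; apply/ltW/hN => //; exact: leq_maxr.
  apply: le_trans (hC _ (Lux m)) _.
  apply: (@le_trans _ _ (C * (d / (C + 1)))).
    by rewrite ler_wpM2l// hK// leq_maxl.
  rewrite mulrCA ger_pMr// ler_pdivrMr ?ltr_wpDl// mul1r lerDl.
  exact: ler01.
have key2 e : 0 < e -> exists N : nat, forall n, (N <= n)%N ->
    smem (fun t => u n t - x t) /\ snrm (fun t => u n t - x t) <= e + e.
  move=> e0; have [N hN] := cu e e0; have [K hK] := ux e e0.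
  exists (maxn K N) => n; rewrite geq_max => /andP[Kn Nn].
  have [b s] := psup_le (key e N e0 hN n Nn); split; first by split.
  by rewrite /snrm lerD// hK.
exists x; split.
  have [N /(_ N (leqnn N))[h _]] := key2 1 ltr01.
  have := (snrmB (mu_ N) h).1.
  by under eq_fun do rewrite opprB addrCA subrr addr0.
move=> e e0; have e4 : 0 < e / 4 by rewrite divr_gt0.
have [N hN] := key2 _ e4; exists N => n /hN[_ /le_lt_trans]; apply.
by lra.
Qed.

Lemma snrm_symmetric_space : is_symmetric_space smem snrm.
Proof.
split; first by move=> x [[]].
split; first by move=> x [Lx bx]; rewrite addr_ge0 ?norm2_ge0// psup_ge0.
split.
  move=> x [Lx bx]; rewrite -norm2_eq0// /snrm; split => [/eqP|x0].
    by rewrite paddr_eq0 ?norm2_ge0 ?psup_ge0// => /andP[/eqP].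
  apply/eqP; rewrite x0 add0r eq_le psup_ge0// andbT; apply: (psup_le _).2 => s.
  by have [C _ hC] := psn_dominated hp s; rewrite (le_trans (hC _ Lx))// x0 mulr0.
split; first exact: snrmD.
split; first exact: snrmZ.
split; first exact: snrm_complete.
split.
  move=> x y [Ly by_] mx xy; have [Lx nx] := norm2_mono mx Ly xy.
  have [s|bx sx] := @psup_le x (psup y).
    by rewrite (le_trans (psn_mono hp s mx Ly xy))// psup_ub.
  by split => //; exact: lerD.
move=> x y [Ly by_] mx xy; have [Lx nx] := norm2_equimeasurable Ly mx xy.
have e : (fun s => p s x) = (fun s => p s y).
  by apply/funext => s; exact: psn_equimeasurable.
by rewrite /smem /snrm /psup /pbounded e nx.
Qed.

Definition seminorm_space : SymSpace R := Build_SymSpace snrm_symmetric_space.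

End SeminormFamily.

(** * The K-functional, Marcinkiewicz seminorms and fundamental functions *)

Section KFunctional.
Set Implicit Arguments.
Unset Strict Implicit.
Context {R : realType}.
Notation mu := (@lebesgue_measure R).
Notation D := (@I01 R).
Implicit Types (x y : R -> R) (s tau : R).

(** The L^1 distance from [x] to the functions bounded by [tau] in absolute value. It integrates a
    function of |x| alone, hence is invariant under rearrangement. *)
Definition excess x tau : R := fine (int01 (fun t => Num.max (`|x t| - tau) 0)).

Let mexc x tau : measurable_fun D x ->
  measurable_fun D (fun t => Num.max (`|x t| - tau) 0).
Proof.
move=> mx; apply: measurable_funrpos; apply: measurable_funB => //.
exact: measurableT_comp.
Qed.

Let exc0 x tau t : 0 <= Num.max (`|x t| - tau) 0.
Proof. by rewrite le_max lexx orbT. Qed.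

Let exc_le_norm x tau t : 0 <= tau -> Num.max (`|x t| - tau) 0 <= `|x t|.
Proof. by move=> tau0; rewrite ge_max normr_ge0 andbT gerBl. Qed.

Lemma int01_excess_le x tau c : inL2 x -> 0 <= tau -> 0 < c -> norm2 x <= c ->
  (int01 (fun t => Num.max (`|x t| - tau) 0)%R <= c%:E)%E.
Proof.
move=> Lx tau0 c0 xc; have [mx _] := Lx.
apply: le_trans (int01_norm_le Lx c0 xc); apply: le_int01 => //.
- exact: mexc.
- exact: measurableT_comp.
- by move=> t _; exact: exc_le_norm.
Qed.

Lemma excessE x tau : inL2 x -> 0 <= tau ->
  int01 (fun t => Num.max (`|x t| - tau) 0) = (excess x tau)%:E.
Proof.
move=> Lx tau0; rewrite /excess fineK// ge0_fin_numE; last exact: int01_ge0.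
apply: le_lt_trans (ltry (norm2 x + 1)).
by apply: int01_excess_le => //; [rewrite ltr_wpDl// norm2_ge0|rewrite lerDl].
Qed.

Lemma excess_ge0 x tau : 0 <= excess x tau.
Proof. by rewrite /excess fine_ge0// int01_ge0. Qed.

Lemma excess_mono x y tau : measurable_fun D x -> inL2 y -> 0 <= tau ->
  (forall t, D t -> `|x t| <= `|y t|) -> excess x tau <= excess y tau.
Proof.
move=> mx Ly tau0 xy; have [Lx _] := norm2_mono mx Ly xy.
rewrite -lee_fin -!excessE//; apply: le_int01 => //.
- exact: mexc.
- by apply: mexc; exact: Ly.1.
- move=> t Dt; rewrite ge_max le_max lerD2r xy//=.
Qed.

(** Pointwise, the part of |x + y| above the sum of two levels is at most the sum of the parts of
    |x| and |y| above their own levels. This yields the triangle inequality for the K-functional. *)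
Lemma excessD x y tau tau' : inL2 x -> inL2 y -> 0 <= tau -> 0 <= tau' ->
  excess (fun t => x t + y t) (tau + tau') <= excess x tau + excess y tau'.
Proof.
move=> Lx Ly tau0 tau'0; have [Lxy _] := norm2D Lx Ly.
rewrite -lee_fin EFinD -!excessE ?addr_ge0// -int01D//; last 2 first.
- by apply: mexc; exact: Lx.1.
- by apply: mexc; exact: Ly.1.
apply: le_int01 => //.
- by apply: mexc; exact: Lxy.1.
- by apply: measurable_funD; apply: mexc; [exact: Lx.1|exact: Ly.1].
- move=> t _; rewrite ge_max addr_ge0// andbT.
  apply: (@le_trans _ _ (`|x t| - tau + (`|y t| - tau'))).
    by have := ler_normD (x t) (y t); lra.
  by rewrite lerD// le_max lexx.
Qed.

Lemma excessZ (a : R) x tau : inL2 x -> 0 <= tau ->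
  excess (fun t => a * x t) (`|a| * tau) = `|a| * excess x tau.
Proof.
move=> Lx tau0; have [Lax _] := norm2Z a Lx.
apply: EFin_inj; rewrite EFinM -!excessE ?mulr_ge0// -int01Z//; last first.
  by apply: mexc; exact: Lx.1.
congr int01; apply/funext => t.
by rewrite maxr_pMr// mulr0 mulrBr normrM.
Qed.

Lemma excess_equimeasurable x y tau : measurable_fun D x -> measurable_fun D y ->
  equimeasurable x y -> excess x tau = excess y tau.
Proof.
move=> mx my xy; rewrite /excess; congr fine.
apply: (@equimeasurable_int01 R (fun u => Num.max (u - tau) 0)) => //.
- by apply: measurable_funrpos; exact: measurable_funB.
- by move=> u _; rewrite le_max lexx orbT.
Qed.

Lemma excess0_le x : inL2 x -> excess x 0 <= norm2 x.
Proof.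
move=> Lx; apply/ler_addgt0Pr => e e0; rewrite -lee_fin -excessE//.
by apply: int01_excess_le => //; [rewrite ltr_wpDl// norm2_ge0|rewrite lerDl ltW].
Qed.

(* Peetre's K-functional of the couple (L^1, L^oo): it equals the integral of the
   decreasing rearrangement of [x] over (0, s), which never has to be defined. *)
Definition Kfun s x : R := inf [set tau * s + excess x tau | tau in [set tau | 0 <= tau]].

Lemma Kfun_le s x tau : 0 <= s -> 0 <= tau -> Kfun s x <= tau * s + excess x tau.
Proof.
move=> s0 tau0; apply: ge_inf; last by exists tau.
by exists 0 => _ [z z0 <-]; rewrite addr_ge0 ?mulr_ge0 ?excess_ge0.
Qed.

Lemma le_Kfun s x c :
  (forall tau, 0 <= tau -> c <= tau * s + excess x tau) -> c <= Kfun s x.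
Proof.
move=> h; apply: lb_le_inf; first by exists (0 * s + excess x 0), 0 => /=.
by move=> _ [z z0 <-]; exact: h.
Qed.

Lemma Kfun_ge0 s x : 0 <= s -> 0 <= Kfun s x.
Proof.
by move=> s0; apply: le_Kfun => z z0; rewrite addr_ge0 ?mulr_ge0 ?excess_ge0.
Qed.

Lemma Kfun_norm2 s x : 0 <= s -> inL2 x -> Kfun s x <= norm2 x.
Proof.
move=> s0 Lx; apply: le_trans (Kfun_le _ s0 (lexx 0)) _.
by rewrite mul0r add0r excess0_le.
Qed.

Lemma KfunD s x y : 0 <= s -> inL2 x -> inL2 y ->
  Kfun s (fun t => x t + y t) <= Kfun s x + Kfun s y.
Proof.
move=> s0 Lx Ly; rewrite -lerBlDr; apply: le_Kfun => tau tau0.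
rewrite lerBlDr -lerBlDl; apply: le_Kfun => tau' tau'0.
rewrite lerBlDl addrACA -mulrDl.
apply: le_trans (Kfun_le _ s0 (addr_ge0 tau0 tau'0)) _.
by rewrite lerD2l excessD.
Qed.

(** For nonzero [a], the map tau -> |a| tau is a bijection of the admissible levels; a = 0 is
    settled by the L^2 bound. *)
Lemma KfunZ s (a : R) x : 0 <= s -> inL2 x ->
  Kfun s (fun t => a * x t) = `|a| * Kfun s x.
Proof.
move=> s0 Lx; have [Lax nax] := norm2Z a Lx; apply/eqP; rewrite eq_le.
have [a0|a0] := eqVneq a 0.
  rewrite [X in `|X|]a0 normr0 mul0r Kfun_ge0// andbT.
  by rewrite (le_trans (Kfun_norm2 s0 Lax))// nax a0 normr0 mul0r.
have a1 : 0 < `|a| by rewrite normr_gt0.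
have E tau : 0 <= tau -> `|a| * tau * s + excess (fun t => a * x t) (`|a| * tau) =
    `|a| * (tau * s + excess x tau).
  by move=> tau0; rewrite excessZ// mulrDr mulrA.
apply/andP; split.
  rewrite mulrC -ler_pdivrMr//; apply: le_Kfun => tau tau0.
  by rewrite ler_pdivrMr// mulrC -E// Kfun_le// mulr_ge0.
apply: le_Kfun => tau tau0; have tau1 : 0 <= tau / `|a| by rewrite divr_ge0.
have <- : `|a| * (tau / `|a|) = tau by rewrite mulrC divfK// gt_eqF.
by rewrite E// ler_wpM2l// Kfun_le.
Qed.

Lemma Kfun_mono s x y : 0 <= s -> measurable_fun D x -> inL2 y ->
  (forall t, D t -> `|x t| <= `|y t|) -> Kfun s x <= Kfun s y.
Proof.
move=> s0 mx Ly xy; apply: le_Kfun => tau tau0.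
by apply: le_trans (Kfun_le _ s0 tau0) _; rewrite lerD2l excess_mono.
Qed.

Lemma Kfun_equimeasurable s x y : measurable_fun D x -> measurable_fun D y ->
  equimeasurable x y -> Kfun s x = Kfun s y.
Proof.
move=> mx my xy; congr inf; congr image; apply/funext => tau.
by rewrite (excess_equimeasurable tau mx my xy).
Qed.

(** The value 0 outside 0 < s <= 1 leaves the supremum unchanged when [phi] is nonnegative, and lets
    the family be indexed by all reals. *)
Definition marcinkiewicz (phi : R -> R) s x : R :=
  if 0 < s <= 1 then phi s / s * Kfun s x else 0.

Lemma marcinkiewicz_seminorms (phi : R -> R) : (forall s, 0 < s <= 1 -> 0 <= phi s) ->
  rearrangement_seminorms (marcinkiewicz phi).
Proof.
move=> phi0; have c0 s : 0 < s <= 1 -> 0 <= phi s / s.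
  by move=> s01; rewrite divr_ge0 ?phi0//; case/andP: s01 => /ltW.
have pos s : 0 < s <= 1 -> 0 <= s by case/andP => /ltW.
split; rewrite /marcinkiewicz => s; case s01 : (0 < s <= 1) => //.
- by move=> x Lx; rewrite mulr_ge0 ?c0 ?Kfun_ge0 ?pos.
- by move=> x y Lx Ly; rewrite -mulrDr ler_wpM2l ?c0 ?KfunD ?pos.
- by move=> a x Lx; rewrite KfunZ ?pos// mulrCA.
- by move=> a x _; rewrite mulr0.
- by move=> x y mx Ly xy; rewrite ler_wpM2l ?c0 ?Kfun_mono ?pos.
- by move=> x y mx Ly xy; rewrite (Kfun_equimeasurable s mx Ly.1 xy).
- by exists (phi s / s); rewrite ?c0// => x Lx; rewrite ler_wpM2l ?c0 ?Kfun_norm2 ?pos.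
- by exists 0 => // x _; rewrite mul0r.
Qed.

Lemma zero_seminorms : rearrangement_seminorms (fun _ _ => 0 : R).
Proof.
split => //.
- by move=> *; rewrite mulr0.
- by move=> s; exists 0 => // x _; rewrite mul0r.
Qed.

Lemma int01_chi0 (t : R) : 0 <= t <= 1 -> int01 (chi0 t) = t%:E.
Proof.
move=> /andP[t0 t1]; have -> : chi0 t = \1_(`]0, t[%classic).
  by apply/funext => u; rewrite indicE /chi0 mem_setE in_itv/=; case: ifP.
rewrite /int01 integral_indic//.
  have -> : `]0, t[ `&` D = `]0, t[%classic.
    apply/setIidl => u /=; rewrite /I01/= !in_itv/= => /andP[u0 ut].
    by rewrite !ltW// (lt_le_trans ut).
  transitivity (mu `]0, t[%classic) => //.
  rewrite lebesgue_measure_itv/= lte_fin; case: ltgtP t0 => // [_ _|<- _].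
    by rewrite oppr0 adde0.
  by [].
exact: measurable_I01.
Qed.

Lemma measurable_chi0 (t : R) : measurable_fun D (chi0 t).
Proof.
have -> : chi0 t = \1_(`]0, t[%classic).
  by apply/funext => u; rewrite indicE /chi0 mem_setE in_itv/=; case: ifP.
exact: measurable_indic.
Qed.

Lemma chi0_ge0 (t u : R) : 0 <= chi0 t u.
Proof. by rewrite /chi0; case: ifP. Qed.

Lemma norm2_chi0 (t : R) : 0 <= t <= 1 -> inL2 (chi0 t) /\ norm2 (chi0 t) = Num.sqrt t.
Proof.
move=> t01; have E : sqint (chi0 t) = t%:E.
  rewrite /sqint -(int01_chi0 t01); congr int01; apply/funext => u.
  by rewrite /chi0; case: ifP => _; rewrite ?expr1n// expr0n.
split; last by rewrite /norm2 E.
by split; [exact: measurable_chi0|rewrite E ltry].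
Qed.

Lemma excess_chi0 (t tau : R) : 0 <= t <= 1 -> 0 <= tau ->
  excess (chi0 t) tau = Num.max (1 - tau) 0 * t.
Proof.
move=> t01 tau0; have m0 : 0 <= Num.max (1 - tau) 0 by rewrite le_max lexx orbT.
suff E : int01 (fun u => Num.max (`|chi0 t u| - tau) 0) =
    (Num.max (1 - tau) 0 * t)%:E by rewrite /excess E.
transitivity ((Num.max (1 - tau) 0)%:E * int01 (chi0 t))%E; last by rewrite int01_chi0.
rewrite -int01Z//; last 2 first.
- exact: measurable_chi0.
- by move=> u _; exact: chi0_ge0.
congr int01; apply/funext => u; rewrite /chi0; case: ifP => _.
  by rewrite normr1 mulr1.
by rewrite normr0 mulr0 sub0r; apply/max_idPr; rewrite oppr_le0.
Qed.

(** The levels 1 and 0 bound the K-functional of the indicator by min (s, t). Quasi-concavity of the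
    weight then puts the maximum of (phi s / s) min (s, t) at s = t, where the bound is attained
    because tau + max (1 - tau, 0) >= 1. *)
Lemma psup_marcinkiewicz_chi0 (phi : R -> R) (t : R) :
  (forall s, 0 < s <= 1 -> 0 <= phi s) ->
  (forall s u, 0 < s -> s <= u -> u <= 1 -> phi s <= phi u) ->
  (forall s u, 0 < s -> s <= u -> u <= 1 -> phi u / u <= phi s / s) ->
  0 < t <= 1 ->
  pbounded (marcinkiewicz phi) (chi0 t) /\ psup (marcinkiewicz phi) (chi0 t) = phi t.
Proof.
move=> phi0 phi1 phi2 /[dup] t01 /andP[t0 t1].
have t01' : 0 <= t <= 1 by rewrite ltW.
have [s|b h] := @psup_le R (marcinkiewicz phi) (chi0 t) (phi t).
  rewrite /marcinkiewicz; case: ifPn => [/[dup] s01 /andP[s0 s1]|_]; last exact: phi0.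
  have c0 : 0 <= phi s / s by rewrite divr_ge0 ?phi0// ltW.
  have [st|ts] := leP s t.
    apply: le_trans (phi1 s t s0 st t1).
    have := Kfun_le (chi0 t) (ltW s0) ler01.
    rewrite excess_chi0// subrr maxxx mul0r addr0 mul1r => /(ler_wpM2l c0).
    by rewrite divfK// gt_eqF.
  have := Kfun_le (chi0 t) (ltW s0) (lexx 0).
  rewrite excess_chi0// subr0 mul0r add0r (max_idPl ler01) mul1r => /(ler_wpM2l c0)/le_trans; apply.
  by rewrite -ler_pdivlMr// phi2// ltW.
split => //; apply/eqP; rewrite eq_le h/=.
apply: le_trans (psup_ub t b); rewrite /marcinkiewicz t01.
rewrite -[leLHS](@divfK _ t) ?gt_eqF// ler_wpM2l ?divr_ge0 ?phi0 ?(ltW t0)//.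
apply: le_Kfun => tau tau0; rewrite excess_chi0// -mulrDl ler_peMl// ?(ltW t0)//.
by rewrite -lerBlDl le_max lexx.
Qed.

End KFunctional.

(** * The logarithmic weight: monotonicity, concavity, behaviour at 0 *)

Section LogWeight.
Set Implicit Arguments.
Unset Strict Implicit.
Context {R : realType}.
Notation mu := (@lebesgue_measure R).
Notation D := (@I01 R).
Implicit Types (s t a b : R).

(** The constant 1 keeps the logarithmic factor at least 1 and makes t (1 - ln t) increasing up to t
    = 1. *)
Definition phi t : R := Num.sqrt (t * (1 - ln t)).

Lemma one_sub_ln_ge1 t : t <= 1 -> 1 <= 1 - ln t.
Proof. by move=> t1; rewrite lerDl oppr_ge0 ln_le0. Qed.

Lemma phi_arg_gt0 t : 0 < t <= 1 -> 0 < t * (1 - ln t).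
Proof.
by move=> /andP[t0 t1]; rewrite mulr_gt0// (lt_le_trans ltr01)// one_sub_ln_ge1.
Qed.

Lemma phi_gt0 t : 0 < t <= 1 -> 0 < phi t.
Proof. by move=> t01; rewrite sqrtr_gt0 phi_arg_gt0. Qed.

Lemma sqr_phi t : 0 < t <= 1 -> phi t ^+ 2 = t * (1 - ln t).
Proof. by move=> t01; rewrite sqr_sqrtr// ltW// phi_arg_gt0. Qed.

Lemma phiE t : 0 < t -> phi t = Num.sqrt t * Num.sqrt (1 - ln t).
Proof. by move=> t0; rewrite /phi sqrtrM// ltW. Qed.

(* [s (1 - ln s)] is the infimum over [t] of the affine functions [t - s ln t]. *)
Lemma phi_arg_le s t : 0 < s -> 0 < t -> s * (1 - ln s) <= t - s * ln t.
Proof.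
move=> s0 t0; have ts : 0 < t / s by rewrite divr_gt0.
have := expR_ge1Dx (ln (t / s)); rewrite lnK ?posrE// ln_div ?posrE// => h.
have := ler_wpM2l (ltW s0) h; rewrite mulrCA divff ?gt_eqF// mulr1.
by lra.
Qed.

Lemma phi_nondecreasing s t : 0 < s -> s <= t -> t <= 1 -> phi s <= phi t.
Proof.
move=> s0 st t1; have t0 := lt_le_trans s0 st.
rewrite ler_wsqrtr//; apply: le_trans (phi_arg_le s0 t0) _.
have := ler_wpM2r (_ : 0 <= - ln t) st; rewrite oppr_ge0 ln_le0// => /(_ isT).
by lra.
Qed.

Lemma phi_div_nonincreasing s t : 0 < s -> s <= t -> t <= 1 -> phi t / t <= phi s / s.
Proof.
move=> s0 st t1; have t0 := lt_le_trans s0 st.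
have E u : 0 < u -> phi u / u = Num.sqrt (1 - ln u) / Num.sqrt u.
  move=> u0; have h : u = Num.sqrt u ^+ 2 by rewrite sqr_sqrtr// ltW.
  rewrite phiE// [X in _ / X = _]h; field.
  by rewrite gt_eqF// sqrtr_gt0.
rewrite !E// ler_pM ?invr_ge0 ?sqrtr_ge0//.
  by rewrite ler_wsqrtr// lerD2l lerN2 ler_ln.
by rewrite lef_pV2 ?posrE ?sqrtr_gt0// ler_wsqrtr.
Qed.

Lemma sqrt_concave (u v l : R) : 0 <= u -> 0 <= v -> 0 <= l <= 1 ->
  l * Num.sqrt u + (1 - l) * Num.sqrt v <= Num.sqrt (l * u + (1 - l) * v).
Proof.
move=> u0 v0 /andP[l0 l1]; have l1' : 0 <= 1 - l by rewrite subr_ge0.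
have c0 : 0 <= l * Num.sqrt u + (1 - l) * Num.sqrt v.
  by rewrite addr_ge0// mulr_ge0// sqrtr_ge0.
rewrite -[leLHS](ger0_norm c0) -sqrtr_sqr ler_wsqrtr//.
rewrite -subr_ge0; move: (sqr_sqrtr u0) (sqr_sqrtr v0).
move: (Num.sqrt u) (Num.sqrt v) => p q <- <-.
have -> : l * p ^+ 2 + (1 - l) * q ^+ 2 - (l * p + (1 - l) * q) ^+ 2 =
    l * (1 - l) * (p - q) ^+ 2 by ring.
by rewrite mulr_ge0 ?sqr_ge0// mulr_ge0.
Qed.

(** Both affine bounds are taken at the same point [w], the convex combination of [s] and [t];
    combined, they give exactly w (1 - ln w). The square root is concave and nondecreasing, so it
    preserves concavity. *)
Lemma phi_concave s t (l : R) : 0 < s <= 1 -> 0 < t <= 1 -> 0 <= l <= 1 ->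
  l * phi s + (1 - l) * phi t <= phi (l * s + (1 - l) * t).
Proof.
move=> s01 t01 l01; have [s0 t0] : 0 < s /\ 0 < t by case/andP: s01; case/andP: t01.
have [l0 l1] := andP l01; have l1' : 0 <= 1 - l by rewrite subr_ge0.
apply: le_trans (sqrt_concave (ltW (phi_arg_gt0 s01)) (ltW (phi_arg_gt0 t01)) l01) _.
set w := l * s + (1 - l) * t; have w0 : 0 < w.
  have [l00|l00] := eqVneq l 0; first by rewrite /w l00 mul0r add0r subr0 mul1r.
  by rewrite ltr_wpDr ?mulr_ge0 ?(ltW t0)// mulr_gt0// lt0r l00.
rewrite ler_wsqrtr//.
have := lerD (ler_wpM2l l0 (phi_arg_le s0 w0)) (ler_wpM2l l1' (phi_arg_le t0 w0)).
by move=> /le_trans; apply; rewrite /w; lra.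
Qed.

Lemma sqrt_div_phi_cvg0 :
  (fun t => Num.sqrt t / (Num.sqrt t + phi t)) @ 0^'+ --> (0 : R).
Proof.
apply/cvgr0Pnorm_lt => e e0; near=> t.
have t0 : 0 < t by near: t; exact: nbhs_right_gt.
have st0 : 0 < Num.sqrt t by rewrite sqrtr_gt0.
(* The quotient equals 1 / (1 + sqrt (1 - ln t)), so t < exp (1 - e^-2) suffices. *)
have Le : (e^-1) ^+ 2 < 1 - ln t.
  rewrite ltrBrDl -ltrBrDr -(expRK (1 - e^-1 ^+ 2)).
  rewrite ltr_ln ?posrE ?expR_gt0//.
  by near: t; apply: nbhs_right_lt; exact: expR_gt0.
have Lt : e^-1 < Num.sqrt (1 - ln t).
  have := Le; rewrite -(ltr_sqrt _ (lt_le_trans _ (ltW Le))); last first.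
    by rewrite exprn_gt0// invr_gt0.
  by rewrite sqrtr_sqr gtr0_norm// invr_gt0.
rewrite phiE// -[X in X + _]mulr1 -mulrDr invfM mulrA divff ?gt_eqF// mul1r.
have q0 : 0 < 1 + Num.sqrt (1 - ln t) by rewrite ltr_wpDr// sqrtr_ge0.
rewrite gtr0_norm ?invr_gt0// -[ltRHS]invrK ltf_pV2 ?posrE ?invr_gt0//.
by rewrite (lt_trans Lt)// ltrDr.
Unshelve. all: by end_near. Qed.

Lemma integral_FTC (f F : R -> R) a b : a < b ->
  (forall t, a <= t <= b -> is_derive t 1 F (f t)) ->
  (forall t, a <= t <= b -> {for t, continuous f}) ->
  (\int[mu]_(t in `[a, b]) (f t)%:E = (F b - F a)%:E)%E.
Proof.
move=> ab dF cf; have cF t : a <= t <= b -> {for t, continuous F}.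
  move=> tab; apply: differentiable_continuous; apply/derivable1_diffP.
  by have [] := dF t tab.
rewrite (@continuous_FTC2 _ f F)// ?EFinB//.
- apply: continuous_in_subspaceT => t; rewrite inE/= in_itv/= => tab; exact: cf.
- split.
  + by move=> t; rewrite in_itv/= => /andP[/ltW at_ /ltW tb]; have [] := dF t; rewrite ?at_.
  + by apply: cvg_at_right_filter; apply: cF; rewrite lexx ltW.
  + by apply: cvg_at_left_filter; apply: cF; rewrite lexx ltW.
- move=> t; rewrite in_itv/= => /andP[/ltW at_ /ltW tb].
  by rewrite derive1E; apply: derive_val; apply: dF; rewrite at_.
Qed.

(** Half-open intervals make consecutive blocks disjoint at every point, while the fundamental
    theorem of calculus is applied on closed ones; the endpoint is null. *)
Lemma restrict_itv01 (f : R -> R) a b : 0 <= a -> b <= 1 ->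
  (forall t, a <= t <= b -> {for t, continuous f}) ->
  measurable_fun D (fun t => if t \in `[a, b[ then f t else 0) /\
  int01 (fun t => if t \in `[a, b[ then f t else 0) =
    (\int[mu]_(t in `[a, b]) (f t)%:E)%E.
Proof.
move=> a0 b1 cf.
have mf : measurable_fun `[a, b[ f.
  apply/measurable_fun_itv_bndo_bndcP.
  apply: subspace_continuous_measurable_fun; first exact: measurable_itv.
  by apply: continuous_in_subspaceT => t; rewrite inE/= in_itv/= => tab; exact: cf.
have E : (fun t => if t \in `[a, b[ then f t else 0) = f \_ `[a, b[.
  by apply/funext => t; rewrite patchE mem_setE.
split.
  rewrite E; apply/measurable_restrict => //; first exact: measurable_I01.
  apply: measurable_funS mf; first exact: measurable_itv.
  exact: subIsetr.
rewrite -integral_itv_bndo_bndc; last exact/measurable_EFinP.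
have -> : `[a, b[%classic = D `&` `[a, b[ :> set R.
  apply/esym/setIidr => t /=; rewrite /I01/= !in_itv/= => /andP[at_ tb].
  by rewrite (le_trans a0)//= (le_trans (ltW tb)).
rewrite integral_mkcondr; apply: eq_integral => t _.
by rewrite patchE mem_setE; case: ifP.
Qed.

End LogWeight.

(** * Blocks of the inverse weight and the two spaces *)

Section DisjointBlocks.
Set Implicit Arguments.
Unset Strict Implicit.
Context {R : realType}.
Notation mu := (@lebesgue_measure R).
Notation D := (@I01 R).
Implicit Types (s t a b : R).

Let phi_ge0 s : 0 < s <= 1 -> 0 <= phi s.
Proof. by move=> s01; exact/ltW/phi_gt0. Qed.

Let continuous_1_ln t : 0 < t -> {for t, continuous (fun u : R => 1 - ln u)}.
Proof. by move=> t0; apply: cvgB; [exact: cvg_cst|exact: continuous_ln]. Qed.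

Let continuous_phi t : 0 < t -> {for t, continuous phi}.
Proof.
move=> t0; have h : {for t, continuous (fun u : R => u * (1 - ln u))}.
  by apply: cvgM; [exact: cvg_id|exact: continuous_1_ln].
apply: (@cvg_comp _ _ _ (fun u : R => u * (1 - ln u)) (@Num.sqrt R) _ _ _ h).
exact: sqrt_continuous.
Qed.

Let continuous_inv_phi t : 0 < t <= 1 -> {for t, continuous (fun u : R => (phi u)^-1)}.
Proof.
move=> /[dup] t01 /andP[t0 t1]; apply: cvgV; last exact: continuous_phi.
by rewrite gt_eqF// phi_gt0.
Qed.

(** The endpoint [a] keeps away from the singularity at 0 but does not enter the bound. The case b
    <= a is included because [b] will be an arbitrary [s] in (0, 1]. *)
Lemma int01_inv_sqrt a b : 0 < a -> b <= 1 ->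
  measurable_fun D (fun t => if t \in `[a, b[ then (Num.sqrt t)^-1 else 0) /\
  (int01 (fun t => if t \in `[a, b[ then (Num.sqrt t)^-1 else 0)%R <=
    (2 * Num.sqrt b)%:E)%E.
Proof.
move=> a0 b1.
have cf t : a <= t <= b -> {for t, continuous (fun u : R => (Num.sqrt u)^-1)}.
  move=> /andP[at_ _]; have t0 := lt_le_trans a0 at_.
  by apply: cvgV; [rewrite gt_eqF// sqrtr_gt0|exact: sqrt_continuous].
have [m ->] := restrict_itv01 (ltW a0) b1 cf; split => //.
have [ab|ba] := ltP a b; last first.
  apply: (@le_trans _ _ 0%E); last by rewrite lee_fin mulr_ge0 ?sqrtr_ge0.
  rewrite le_eqVlt; apply/orP; left; apply/eqP.
  have [/eqP->|nab] := boolP (b == a); first by rewrite set_itv1 integral_set1.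
  by rewrite set_itv_ge ?integral_set0// bnd_simp -ltNge lt_neqAle nab.
have dF t : a <= t <= b -> is_derive t 1 (fun u : R => 2 * Num.sqrt u) (Num.sqrt t)^-1.
  move=> /andP[at_ _]; have t0 := lt_le_trans a0 at_.
  have d := is_derive1_sqrt t0.
  by apply: is_derive_eq; rewrite /GRing.scale/= invfM mulrA divff ?mul1r.
by rewrite (integral_FTC ab dF cf) lee_fin gerBl mulr_ge0 ?sqrtr_ge0.
Qed.

Lemma int01_inv_phi_sqr a b : 0 < a -> a < b -> b <= 1 ->
  int01 (fun t => if t \in `[a, b[ then (phi t)^-1 ^+ 2 else 0) =
    (ln (1 - ln a) - ln (1 - ln b))%:E.
Proof.
move=> a0 ab b1.
have t01 t : a <= t <= b -> 0 < t <= 1.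
  by move=> /andP[at_ tb]; rewrite (lt_le_trans a0 at_) (le_trans tb).
have cf t : a <= t <= b -> {for t, continuous (fun u : R => (phi u)^-1 ^+ 2)}.
  by move=> tab; have c := continuous_inv_phi (t01 t tab); exact: (cvgM c c).
have dF t : a <= t <= b ->
    is_derive t 1 (fun u : R => - ln (1 - ln u)) ((phi t)^-1 ^+ 2).
  move=> tab; have /andP[t0 t1] := t01 t tab.
  have L0 : 0 < 1 - ln t by rewrite (lt_le_trans ltr01)// one_sub_ln_ge1.
  have d1 := is_derive1_ln t0.
  have d2 : is_derive t 1 (fun u : R => 1 - ln u) (- t^-1).
    by apply: is_derive_eq; rewrite add0r mul1r.
  have d3 := @is_derive1_comp R (@ln R) (fun u => 1 - ln u) t _ _ (is_derive1_ln L0) d2.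
  have d4 : is_derive t 1 (fun u : R => - ln (1 - ln u)) (- ((1 - ln t)^-1 * - t^-1)).
    exact: is_deriveN.
  by apply: is_derive_eq; rewrite exprVn sqr_phi ?t01// invfM mulrN opprK mulrC.
have [_ ->] := restrict_itv01 (ltW a0) b1 cf.
by rewrite (integral_FTC ab dF cf) opprK addrC.
Qed.

(** Test the K-functional at the level B / phi s. As [phi] is nondecreasing, |z| can exceed it only
    for t < s, where 1 - ln t >= 1 - ln s bounds 1 / phi t by t^(-1/2) / sqrt (1 - ln s). The level
    contributes B s / phi s and the excess at most 2 B s / phi s, whence the factor 3, independent
    of [a]. *)
Lemma marcinkiewicz_le (z : R -> R) a B s : 0 < a -> 0 <= B -> inL2 z ->
  (forall t, D t -> `|z t| <= if t \in `[a, 1[ then B * (phi t)^-1 else 0) ->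
  marcinkiewicz phi s z <= 3 * B.
Proof.
move=> a0 B0 Lz zB; rewrite /marcinkiewicz; case: ifPn => [/[dup] s01 /andP[s0 s1]|_];
  last by rewrite mulr_ge0.
have ps0 := phi_gt0 s01; have tau0 : 0 <= B / phi s by rewrite divr_ge0// ltW.
have L1 t : t <= 1 -> 0 < Num.sqrt (1 - ln t).
  by move=> t1; rewrite sqrtr_gt0 (lt_le_trans ltr01)// one_sub_ln_ge1.
have ss0 : 0 < Num.sqrt s by rewrite sqrtr_gt0.
pose c := B / Num.sqrt (1 - ln s).
have c0 : 0 <= c by rewrite divr_ge0// ltW// L1.
have [mi hi] := int01_inv_sqrt a0 s1.
have i0 t : 0 <= if t \in `[a, s[ then (Num.sqrt t)^-1 else 0.
  by case: ifP => _ //; rewrite invr_ge0 sqrtr_ge0.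
have ex : excess z (B / phi s) <= c * (2 * Num.sqrt s).
  rewrite -lee_fin -excessE// EFinM.
  apply: le_trans (lee_wpmul2l _ hi); last by rewrite lee_fin.
  rewrite -int01Z//; apply: le_int01.
  - apply: measurable_funrpos; apply: measurable_funB => //.
    by apply: measurableT_comp => //; exact: Lz.1.
  - exact: measurable_funM.
  - by move=> t _; rewrite le_max lexx orbT.
  - move=> t Dt; rewrite ge_max mulr_ge0 ?i0// andbT lerBlDr.
    apply: le_trans (zB t Dt) _; move: (i0 t); rewrite !in_itv/= => i0t.
    case: ifPn => [/andP[at_ t1]|_]; last by rewrite addr_ge0// mulr_ge0.
    have t0 := lt_le_trans a0 at_; rewrite at_/=; case: ltP => [ts|st].
      rewrite (@le_trans _ _ (c * (Num.sqrt t)^-1)) ?lerDl//.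
      rewrite /c -mulrA ler_wpM2l// phiE// invfM mulrC ler_wpM2r ?invr_ge0 ?sqrtr_ge0//.
      rewrite lef_pV2 ?posrE ?L1 ?(ltW t1)// ler_wsqrtr// lerD2l lerN2.
      by rewrite ler_ln ?posrE// ltW.
    rewrite mulr0 add0r ler_wpM2l// lef_pV2 ?posrE ?ps0 ?phi_gt0 ?t0 ?(ltW t1)//.
    by rewrite phi_nondecreasing// ltW.
apply: (@le_trans _ _ (phi s / s * (B / phi s * s + c * (2 * Num.sqrt s)))).
  rewrite ler_wpM2l ?divr_ge0 ?(ltW ps0) ?(ltW s0)//.
  by apply: le_trans (Kfun_le z (ltW s0) tau0) _; rewrite lerD2l.
have h : s = Num.sqrt s ^+ 2 by rewrite sqr_sqrtr// ltW.
rewrite le_eqVlt; apply/orP; left; apply/eqP.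
have L0 := L1 s s1; rewrite /c phiE//; move: ss0 L0 h.
move: (Num.sqrt s) (Num.sqrt (1 - ln s)) => q l q0 l0 ->.
by field; rewrite !gt_eqF.
Qed.

Definition node (n : nat) : R := expR (1 - expR n%:R).

Lemma node_gt0 n : 0 < node n. Proof. exact: expR_gt0. Qed.

Lemma node_decreasing m n : (m < n)%N -> node n < node m.
Proof. by move=> mn; rewrite ltr_expR ltrD2l ltrN2 ltr_expR ltr_nat. Qed.

Lemma node_nonincreasing m n : (m <= n)%N -> node n <= node m.
Proof. by move=> mn; rewrite ler_expR lerD2l lerN2 ler_expR ler_nat. Qed.

Lemma node0 : node 0 = 1. Proof. by rewrite /node expR0 subrr expR0. Qed.

Lemma node_le1 n : node n <= 1.
Proof. by rewrite -node0 node_nonincreasing. Qed.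

(* [node n] is chosen so that the blocks of [1 / phi] are normalised in [L^2]:
   the antiderivative [- ln (1 - ln t)] of [1 / phi^2] takes the value [- n] there. *)
Definition block n t : R := if t \in `[node n.+1, node n[ then (phi t)^-1 else 0.

Lemma block_ge0 n t : 0 <= block n t.
Proof. by rewrite /block; case: ifP => // _; rewrite invr_ge0 sqrtr_ge0. Qed.

Lemma block_L2 n : inL2 (block n) /\ norm2 (block n) = 1.
Proof.
have [t /andP[t0 t1]|mb _] :=
    @restrict_itv01 R (fun t => (phi t)^-1) _ _ (ltW (node_gt0 n.+1)) (node_le1 n).
  apply: continuous_inv_phi; rewrite (lt_le_trans (node_gt0 _) t0)/=.
  exact: le_trans (node_le1 n).
have E : sqint (block n) = 1%E.
  rewrite /sqint.
  have -> : (fun t => block n t ^+ 2) =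
      (fun t => if t \in `[node n.+1, node n[ then (phi t)^-1 ^+ 2 else 0).
    by apply/funext => t; rewrite /block; case: ifP; rewrite ?expr0n.
  rewrite int01_inv_phi_sqr ?node_gt0 ?node_decreasing ?node_le1//.
  have e x : 1 - (1 - x) = x :> R by ring.
  by rewrite /node !expRK !e !expRK -natr1 addrC addKr.
split; last by rewrite /norm2 E sqrtr1.
by split => //; rewrite E ltry.
Qed.

Lemma block_disjoint m n t : m != n -> block m t * block n t = 0.
Proof.
wlog mn : m n / (m < n)%N.
  move=> h; rewrite neq_ltn => /orP[mn|nm]; first by rewrite h// ltn_eqF.
  by rewrite mulrC h// ltn_eqF.
move=> _; rewrite /block !in_itv/=; case: ifP => [/andP[mt _]|_]; last by rewrite mul0r.
case: ifP => [/andP[_ tn]|_]; last by rewrite mulr0.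
have := lt_le_trans tn (le_trans (node_nonincreasing mn) mt).
by rewrite ltxx.
Qed.

Lemma sum_block n t :
  \sum_(i < n) block i t = if t \in `[node n, 1[ then (phi t)^-1 else 0.
Proof.
elim: n => [|n IH].
  rewrite big_ord0 in_itv/= node0; case: ifP => // /andP[t1 t1'].
  by have := le_lt_trans t1 t1'; rewrite ltxx.
rewrite big_ord_recr/= IH /block !in_itv/=.
have lt1 := node_decreasing (ltnSn n); have le1 := node_le1 n.
case: (leP (node n) t) => h1; case: (leP (node n.+1) t) => h2; case: (ltP t 1) => h3 //=;
  rewrite ?addr0 ?add0r//.
- by have := le_lt_trans h1 h2; rewrite ltNge (ltW lt1).
- by have := lt_le_trans h1 (le_trans le1 h3); rewrite ltxx.
Qed.

Lemma block_sum_L2 (n : nat) (c : nat -> R) :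
  inL2 (fun t => \sum_(i < n) c i * block i t).
Proof.
elim: n => [|n IH].
  under eq_fun do rewrite big_ord0.
  have := (norm2Z 0 (block_L2 0).1).1.
  by under eq_fun do rewrite mul0r.
under eq_fun do rewrite big_ord_recr/=.
exact: (norm2D IH (norm2Z (c n) (block_L2 n).1).1).1.
Qed.

Lemma marcinkiewicz_block_sum (n : nat) (c : nat -> R) s :
  marcinkiewicz phi s (fun t => \sum_(i < n) c i * block i t) <=
  3 * norm2 (fun t => \sum_(i < n) c i * block i t).
Proof.
set z := fun t => _; have Lz : inL2 z by exact: block_sum_L2.
have cz (i : 'I_n) : `|c i| <= norm2 z.
  have [Li ni] := block_L2 i; have [Lci nci] := norm2Z (c i) Li.
  rewrite -[leLHS]mulr1 -ni -nci; apply: (norm2_mono _ Lz _).2 => [|t Dt].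
    exact: Lci.1.
  (* Where block [i] does not vanish all the others do, so [z] coincides there with its term of
     index [i]. *)
  have [b0|b0] := eqVneq (block i t) 0; first by rewrite b0 mulr0 normr0.
  rewrite /z (bigD1 i)//= big1 ?addr0// => j ji.
  have /eqP := block_disjoint t ji; rewrite mulf_eq0 (negbTE b0) orbF => /eqP->.
  by rewrite mulr0.
apply: (marcinkiewicz_le s (node_gt0 n) (norm2_ge0 z) Lz) => t Dt.
apply: (@le_trans _ _ (norm2 z * \sum_(i < n) block i t)).
  rewrite /z mulr_sumr; apply: le_trans (ler_norm_sum _ _ _) _.
  by apply: ler_sum => i _; rewrite normrM (ger0_norm (block_ge0 _ _)) ler_wpM2r ?block_ge0.
by rewrite sum_block; case: ifP; rewrite ?mulr0.
Qed.

Definition L2_space : SymSpace R := seminorm_space (@zero_seminorms R).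

Definition L2_marcinkiewicz_space : SymSpace R :=
  seminorm_space (marcinkiewicz_seminorms phi_ge0).

Lemma nrm_L2_space (x : R -> R) : ss_nrm L2_space x = norm2 x.
Proof.
rewrite /= /snrm /psup; have -> : range (fun _ : R => 0 : R) = [set 0].
  by apply/seteqP; split => [_ [s _ <-]//|_ ->]; exists 0.
by rewrite sup1 addr0.
Qed.

Lemma mem_L2_space (x : R -> R) : inL2 x -> ss_mem L2_space x.
Proof. by move=> Lx; split => //; exists 0 => _ [s _ <-]. Qed.

Let psup_chi0 t (t01 : 0 < t <= 1) := psup_marcinkiewicz_chi0 phi_ge0
  (@phi_nondecreasing R) (@phi_div_nonincreasing R) t01.

Lemma fund_L2_space t : 0 <= t <= 1 -> fund L2_space t = Num.sqrt t.
Proof. by move=> t01; rewrite /fund nrm_L2_space (norm2_chi0 t01).2. Qed.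

Lemma fund_L2_marcinkiewicz_space t : 0 < t <= 1 ->
  fund L2_marcinkiewicz_space t = Num.sqrt t + phi t.
Proof.
move=> /[dup] t01 /andP[t0 t1]; rewrite /fund /= /snrm (psup_chi0 t01).2.
by rewrite (norm2_chi0 _).2// ltW.
Qed.

End DisjointBlocks.

(** * The inclusion and the equivalence of norms on the closed span *)

Theorem theorem3 (R : realType) :
  exists E F : SymSpace R,
    in_G (fund E) /\ in_G (fund F) /\ ss_included E F /\ incl_bounded E F /\
    (fun t => fund F t / fund E t) @ 0^'+ --> (0 : R) /\
    ~ incl_DSS E F.
Proof.
exists (@L2_marcinkiewicz_space R), (@L2_space R).
have cvx (s t l : R) : 0 < s <= 1 -> 0 < t <= 1 -> 0 <= l <= 1 ->
    0 < l * s + (1 - l) * t <= 1.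
  move=> /andP[s0 s1] /andP[t0 t1] /andP[l0 l1]; apply/andP; split; last by nra.
  have [->|l00] := eqVneq l 0; first by rewrite mul0r add0r subr0 mul1r.
  by rewrite ltr_wpDr ?mulr_ge0 ?subr_ge0 ?(ltW t0)// mulr_gt0// lt0r l00.
have w (t : R) : 0 < t <= 1 -> 0 <= t <= 1 by move=> /andP[/ltW-> ->].
have mp := marcinkiewicz_seminorms (fun s s01 => ltW (@phi_gt0 R s s01)).
have nE (x : R -> R) : ss_mem (@L2_marcinkiewicz_space R) x ->
    norm2 x <= ss_nrm (@L2_marcinkiewicz_space R) x.
  by move=> mx; exact: (norm2_snrm mp mx).
split; [split|split; [split|split; [|split; [|split]]]].
- by move=> t t01; rewrite fund_L2_marcinkiewicz_space// ltr_wpDl ?sqrtr_ge0// phi_gt0.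
- move=> s t s0 st t1; have s01 : 0 < s <= 1 by rewrite s0 (le_trans st).
  have t01 : 0 < t <= 1 by rewrite (lt_le_trans s0 st).
  by rewrite !fund_L2_marcinkiewicz_space// lerD ?phi_nondecreasing// ler_wsqrtr.
- move=> s t l s01 t01 l01; rewrite !fund_L2_marcinkiewicz_space ?cvx//.
  rewrite !mulrDr addrACA lerD ?phi_concave// sqrt_concave//.
    by case/andP: s01 => /ltW.
  by case/andP: t01 => /ltW.
- by move=> t t01; rewrite fund_L2_space ?w// sqrtr_gt0; case/andP: t01.
- move=> s t s0 st t1; rewrite !fund_L2_space ?ler_wsqrtr//.
    by rewrite (ltW (lt_le_trans s0 st)).
  by rewrite (ltW s0) (le_trans st).
- move=> s t l s01 t01 l01; rewrite !fund_L2_space ?w ?cvx// sqrt_concave//.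
    by case/andP: s01 => /ltW.
  by case/andP: t01 => /ltW.
- by move=> x [Lx _]; exact: mem_L2_space.
- by exists 1; split => // x mx; rewrite mul1r nrm_L2_space nE.
- have := @sqrt_div_phi_cvg0 R; apply: cvg_trans; apply: near_eq_cvg; near=> t.
  have t01 : 0 < t <= 1.
    apply/andP; split; first by near: t; exact: nbhs_right_gt.
    by near: t; apply: nbhs_right_le; exact: ltr01.
  by rewrite fund_L2_space ?w// fund_L2_marcinkiewicz_space.
apply; exists (@block R); split.
- move=> n; have [Ln nn] := @block_L2 R n.
  have mE : ss_mem (@L2_marcinkiewicz_space R) (block n).
    (* A single block lies below the sum of blocks 0 to n, that is, below [1 / phi] cut off at
       [node n.+1], so the estimate applies with B = 1. *)
    split => //; have [s|//] := @psup_le R (marcinkiewicz phi) (block n) (3 * 1).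
    apply: (marcinkiewicz_le s (node_gt0 n.+1) ler01 Ln) => t Dt.
    rewrite mul1r -sum_block big_ord_recr/= (ger0_norm (block_ge0 _ _)) lerDr.
    by apply: sumr_ge0 => i _; exact: block_ge0.
  split => // e; have := nE _ mE; rewrite e nn.
  by rewrite leNgt ltr01.
- move=> n m /eqP nm; rewrite /ae01.
  have -> : [set t | I01 t /\ block n t * block m t <> 0] = set0 :> set R.
    by apply/seteqP; split => t // [_]; apply; exact: block_disjoint.
  exact: negligible_set0.
(* On combinations of blocks the larger norm is at most 1 + 3 times the L^2 norm. *)
exists (4^-1), 1; split; first by rewrite invr_gt0.
split => // x [mx hx]; rewrite mul1r nrm_L2_space; split; last exact: nE.
rewrite mulrC ler_pdivrMr//; apply/ler_addgt0Pr => e e0.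
(* Replacing [x] by a block sum [z] costs the norm of x - z once directly and four times through 4
   [norm2 z]. *)
have e5 : 0 < e / 5 by rewrite divr_gt0.
have [n [c]] := hx _ e5; set z := fun t => \sum_(i < n) c i * block i t.
rewrite -/(z _) => xz.
have pz s : marcinkiewicz phi s z <= 3 * norm2 z by exact: marcinkiewicz_block_sum.
have Lz : inL2 z by exact: block_sum_L2.
have [bz sz] := psup_le pz.
have mz : ss_mem (@L2_marcinkiewicz_space R) z by split.
have mxz := (snrmB mp mx mz).1.
have h1 : ss_nrm (@L2_marcinkiewicz_space R) x <=
    ss_nrm (@L2_marcinkiewicz_space R) (fun t => x t - z t) + 4 * norm2 z.
  have := (snrmD mp mxz mz).2.
  under eq_fun do rewrite subrK.
  move=> /le_trans; apply; rewrite lerD2l /snrm.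
  apply: le_trans (lerD (lexx _) sz) _; rewrite -/z.
  by lra.
have h2 : norm2 z <= norm2 x + norm2 (fun t => x t - z t).
  have := (norm2B mx.1 mxz.1).2.
  by under eq_fun do rewrite opprB addrCA subrr addr0.
have h3 := nE _ mxz.
by lra.
Unshelve. all: by end_near. Qed.
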